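(* Let $\alpha>0$, let $\Lambda$ be a finite graph, and let $\Psi$ be a commuting interaction on $\Lambda$ with $\|\Psi\|_{F_\alpha}<\infty$, where $F_\alpha(r)=(1+r)^{-\alpha}$. Then for all disjoint $X,Y\subset\Lambda$, all $A\in\mathcal{A}_X$, $B\in\mathcal{A}_Y$ and all $t\in\mathbb{R}$, $$\big\|[\tau^\Lambda_t(A),B]\big\|\le 4\,\|\Psi\|_{F_\alpha}\,\|A\|\,\|B\|\,|X|\,|Y|\,|t|\,F_\alpha(\mathrm{dist}(X,Y)).$$
   Context: $\Lambda$ has graph distance $d$. Each site carries $\mathbb{C}^q$, $\mathcal{A}_Z=\mathcal{B}(\bigotimes_{x\in Z}\mathbb{C}^q)$ embedded in $\mathcal{A}_\Lambda$ via $A\mapsto A\otimes\mathbf{1}$. An interaction assigns to each $Z\subset\Lambda$ a self-adjoint $\Psi(Z)\in\mathcal{A}_Z$; it is commuting if $[\Psi(Z),\Psi(Z')]=0$ for all $Z,Z'$. $\|\Psi\|_F=\sup_{x,y\in\Lambda}\sum_{Z\ni x,y}\|\Psi(Z)\|/F(d(x,y))$. $H_\Lambda=\sum_{Z\subset\Lambda}\Psi(Z)$ and $\tau^\Lambda_t(A)=e^{itH_\Lambda}Ae^{-itH_\Lambda}$. *)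

(* Defs.v *)
From HB Require Import structures.
From mathcomp Require Import all_boot all_order all_algebra.
From mathcomp Require Import all_classical all_reals all_analysis.
From mathcomp Require Import complex.
Set Implicit Arguments. Unset Strict Implicit. Unset Printing Implicit Defensive.
Import Order.TTheory GRing.Theory Num.Theory.
Import numFieldNormedType.Exports.
Local Open Scope ring_scope.

Fixpoint walk (V : finType) (adj : rel V) (n : nat) (x y : V) : bool :=
  if n is n'.+1 then [exists z, adj x z && walk adj n' z y] else x == y.

(* Graph distance; [None] encodes distance +infinity (x, y in different
   connected components).  If x and y are connected, a shortest walk has
   length < #|V|, so the least such length is found in [iota 0 #|V|]. *)
Definition gdist (V : finType) (adj : rel V) (x y : V) : option nat :=
  if [exists n : 'I_#|V|, walk adj n x y]
  then Some (find (fun n => walk adj n x y) (iota 0 #|V|))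
  else None.

Definition omin (a b : option nat) : option nat :=
  match a, b with
  | None, _ => b
  | _, None => a
  | Some m, Some n => Some (minn m n)
  end.

Definition setdist (V : finType) (adj : rel V) (X Y : {set V}) : option nat :=
  \big[omin/None]_(x in X) \big[omin/None]_(y in Y) gdist adj x y.

Definition Falpha (R : realType) (alpha : R) (r : option nat) : R :=
  match r with
  | Some n => (1 + n%:R) `^ (- alpha)
  | None => 0
  end.

(* classical configurations: basis vectors of the tensor product *)
Definition conf (V : finType) (q : nat) := {ffun V -> 'I_q}.

(* Operators on the total Hilbert space (an element of A_Lambda), as matrices
   in the product basis indexed by configurations. *)
Definition op (R : realType) (V : finType) (q : nat) := 'M[R[i]]_#|conf V q|.

Definition cfg (V : finType) (q : nat) (i : 'I_#|conf V q|) : conf V q :=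
  enum_val i.

Definition confZ (V : finType) (q : nat) (Z : {set V}) :=
  {ffun {x : V | x \in Z} -> 'I_q}.

Definition restr (V : finType) (q : nat) (Z : {set V}) (s : conf V q)
  : confZ q Z := [ffun x => s (val x)].

(* the embedding  a |-> a (x) 1  of B(tensor_{x in Z} C^q) into A_Lambda *)
Definition embed (R : realType) (V : finType) (q : nat) (Z : {set V})
  (a : confZ q Z -> confZ q Z -> R[i]) : op R V q :=
  \matrix_(i, j)
    (a (restr Z (cfg i)) (restr Z (cfg j))
     * (([forall x, (x \notin Z) ==> (cfg i x == cfg j x)]%:R) : R[i])).

Definition local (R : realType) (V : finType) (q : nat) (Z : {set V})
  (A : op R V q) : Prop :=
  exists a : confZ q Z -> confZ q Z -> R[i], A = embed a.

Definition adj_op (R : realType) (V : finType) (q : nat) (A : op R V q)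
  : op R V q := \matrix_(i, j) (A j i)^*.

Definition selfadj (R : realType) (V : finType) (q : nat) (A : op R V q) :=
  adj_op A = A.

Definition vnorm (R : realType) (n : nat) (v : 'cV[R[i]]_n) : R :=
  Num.sqrt (\sum_i (ComplexField.Normc.normc (v i 0)) ^+ 2).

Definition opnorm (R : realType) (n : nat) (A : 'M[R[i]]_n) : R :=
  sup [set r : R | exists v : 'cV[R[i]]_n, vnorm v = 1 /\ r = vnorm (A *m v)].

Definition comm (R : realType) (n : nat) (A B : 'M[R[i]]_n) : 'M[R[i]]_n :=
  A *m B - B *m A.

Definition mxpow (R : realType) (n : nat) (M : 'M[R[i]]_n) (k : nat) :=
  iter k (mulmx M) 1%:M.

Definition expsum (R : realType) (n : nat) (M : 'M[R[i]]_n) (N : nat)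
  : 'M[R[i]]_n :=
  \sum_(k < N) ((k`!%:R)^-1 *: mxpow M k).

Definition expmx (R : realType) (n : nat) (M : 'M[R[i]]_n) : 'M[R[i]]_n :=
  \matrix_(i, j)
    ((limn (fun N => complex.Re (expsum M N i j)))
       +i* (limn (fun N => complex.Im (expsum M N i j))))%C.

Definition interaction (R : realType) (V : finType) (q : nat)
  (Psi : {set V} -> op R V q) : Prop :=
  forall Z, local Z (Psi Z) /\ selfadj (Psi Z).

Definition commuting (R : realType) (V : finType) (q : nat)
  (Psi : {set V} -> op R V q) : Prop :=
  forall Z Z', Psi Z *m Psi Z' = Psi Z' *m Psi Z.

Definition psum (R : realType) (V : finType) (q : nat)
  (Psi : {set V} -> op R V q) (x y : V) : R :=
  \sum_(Z : {set V} | (x \in Z) && (y \in Z)) opnorm (Psi Z).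

Definition Fnorm_finite (R : realType) (V : finType) (adj : rel V) (q : nat)
  (F : option nat -> R) (Psi : {set V} -> op R V q) : Prop :=
  exists C : R, forall x y, psum Psi x y <= C * F (gdist adj x y).

(* ||Psi||_F = sup_{x,y} psum / F(d(x,y)); Lambda is finite so the sup is a
   max of nonnegative numbers.  When ||Psi||_F is finite, pairs at infinite
   distance have psum = 0 and contribute 0 (MathComp convention 0/0 = 0). *)
Definition Fnorm (R : realType) (V : finType) (adj : rel V) (q : nat)
  (F : option nat -> R) (Psi : {set V} -> op R V q) : R :=
  \big[Num.max/0]_(x : V) \big[Num.max/0]_(y : V)
     (psum Psi x y / F (gdist adj x y)).

Definition hamiltonian (R : realType) (V : finType) (q : nat)
  (Psi : {set V} -> op R V q) : op R V q :=
  \sum_(Z : {set V}) Psi Z.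

Definition tau (R : realType) (V : finType) (q : nat)
  (Psi : {set V} -> op R V q) (t : R) (A : op R V q) : op R V q :=
  expmx (('i * t%:C)%C *: hamiltonian Psi) *m A
    *m expmx ((- ('i * t%:C))%C *: hamiltonian Psi).

(* Main.v *)
(** Only the interaction terms meeting both X and Y matter: writing
    H = L1 + K + L2 with L2 the terms not meeting X, L1 those meeting X but not
    Y, and K those meeting both, all three commute, exp(itL2) commutes with A
    and drops out, and exp(itL1) is a unitary commuting with B, so that
    ||[tau_t(A), B]|| <= ||[exp(itK) A exp(-itK) - A, B]||
    <= 4 ||A|| ||B|| ||exp(itK) - 1||.  Finally ||exp(itK) - 1|| <= |t| ||K||,
    and ||K|| is at most the sum of [psum Psi x y] over x in X and y in Y. *)

Require Import Defs.
From HB Require Import structures.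
From mathcomp Require Import all_boot all_order all_algebra.
From mathcomp Require Import all_classical all_reals all_analysis.
From mathcomp Require Import complex ring lra.
Set Implicit Arguments. Unset Strict Implicit. Unset Printing Implicit Defensive.
Import Order.TTheory GRing.Theory Num.Theory.
Import numFieldNormedType.Exports.
Local Open Scope ring_scope.

(** * Operator norms *)

Notation normc := ComplexField.Normc.normc.

Section Norms.
Variable R : realType.
Implicit Types (z : R[i]) (n : nat).

Lemma normc_ge0 z : 0 <= normc z.
Proof. by case: z => a b; exact: sqrtr_ge0. Qed.

Lemma normcJ z : normc z^* = normc z.
Proof. by case: z => a b; rewrite /= sqrrN. Qed.

Lemma normc_real (r : R) : normc r%:C%C = `|r|.
Proof. by rewrite /= expr0n addr0 sqrtr_sqr. Qed.

Lemma Re_le_normc z : `|complex.Re z| <= normc z.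
Proof. by case: z => a b /=; rewrite -sqrtr_sqr ler_sqrt ?addr_ge0 ?sqr_ge0// lerDl sqr_ge0. Qed.

Lemma Im_le_normc z : `|complex.Im z| <= normc z.
Proof. by case: z => a b /=; rewrite -sqrtr_sqr ler_sqrt ?addr_ge0 ?sqr_ge0// lerDr sqr_ge0. Qed.

Lemma normc_le_ReIm z : normc z <= `|complex.Re z| + `|complex.Im z|.
Proof.
case: z => a b /=; rewrite -[leRHS]ger0_norm ?addr_ge0// -sqrtr_sqr.
rewrite ler_sqrt ?sqr_ge0// sqrrD !real_normK ?num_real// -addrA lerD2l lerDr.
by rewrite mulrn_wge0// mulr_ge0.
Qed.

Lemma sqr_normcE z : ((normc z) ^+ 2)%:C%C = z^* * z.
Proof. by rewrite mulrC -[RHS](sqr_normc z) rmorphXn. Qed.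

(** Lagrange's identity: twice the defect is the sum of the squares of [a i * b j - a j * b i]. *)
Lemma cauchy_schwarz_sum (I : finType) (a b : I -> R) :
  (\sum_i a i * b i) ^+ 2 <= (\sum_i a i ^+ 2) * (\sum_i b i ^+ 2).
Proof.
have h : 0 <= \sum_i \sum_j (a i * b j - a j * b i) ^+ 2.
  by apply: sumr_ge0 => i _; apply: sumr_ge0 => j _; exact: sqr_ge0.
suff e : \sum_i \sum_j (a i * b j - a j * b i) ^+ 2 =
  2 * ((\sum_i a i ^+ 2) * (\sum_i b i ^+ 2) - (\sum_i a i * b i) ^+ 2).
  by move: h; rewrite e pmulr_rge0// subr_ge0.
pose G i j := a i ^+ 2 * b j ^+ 2 - a i * b i * (a j * b j).
have -> : (\sum_i a i ^+ 2) * (\sum_i b i ^+ 2) - (\sum_i a i * b i) ^+ 2 =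
    \sum_i \sum_j G i j.
  rewrite expr2 !big_distrlr -sumrB; apply: eq_bigr => i _ /=.
  by rewrite -sumrB.
(* One of the two copies of the double sum gets its indices swapped, so each square is matched with
   [G i j + G j i]. *)
rewrite mulr_natl mulr2n [X in _ = _ + X]exchange_big -big_split.
apply: eq_bigr => i _; rewrite -big_split; apply: eq_bigr => j _ /=.
by rewrite /G; ring.
Qed.

(** * The Euclidean norm of complex vectors *)

Section Vectors.
Variable n : nat.
Implicit Types (v w : 'cV[R[i]]_n).

Lemma vnorm_ge0 v : 0 <= vnorm v.
Proof. exact: sqrtr_ge0. Qed.

Lemma sum_sqr_normc_ge0 v : 0 <= \sum_i (normc (v i 0)) ^+ 2.
Proof. by apply: sumr_ge0 => i _; exact: sqr_ge0. Qed.

Lemma sqr_vnorm v : vnorm v ^+ 2 = \sum_i (normc (v i 0)) ^+ 2.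
Proof. by rewrite sqr_sqrtr ?sum_sqr_normc_ge0. Qed.

Lemma vnorm0 : vnorm (0 : 'cV[R[i]]_n) = 0.
Proof.
rewrite /vnorm big1 ?sqrtr0// => i _.
by rewrite mxE ComplexField.Normc.normc0 expr0n.
Qed.

Lemma vnorm_eq0 v : vnorm v = 0 -> v = 0.
Proof.
move=> v0; have := sqr_vnorm v; rewrite v0 expr0n /= => /esym/eqP.
rewrite psumr_eq0 => [/allP v0i|i _]; last exact: sqr_ge0.
apply/matrixP => i j; rewrite (ord1 j) mxE.
have := v0i i (mem_index_enum i); rewrite /= sqrf_eq0 => /eqP.
exact: ComplexField.Normc.eq0_normc.
Qed.

Lemma normc_le_vnorm v i : normc (v i 0) <= vnorm v.
Proof.
rewrite -[leLHS]ger0_norm ?normc_ge0// -sqrtr_sqr ler_sqrt ?sum_sqr_normc_ge0//.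
by rewrite (bigD1 i)//= lerDl; apply: sumr_ge0 => j _; exact: sqr_ge0.
Qed.

Lemma vnormZ z v : vnorm (z *: v) = normc z * vnorm v.
Proof.
have -> : vnorm (z *: v) = Num.sqrt ((normc z) ^+ 2 * vnorm v ^+ 2).
  rewrite sqr_vnorm mulr_sumr /vnorm; congr Num.sqrt.
  by apply: eq_bigr => i _; rewrite mxE ComplexField.Normc.normcM exprMn.
by rewrite -exprMn sqrtr_sqr ger0_norm// mulr_ge0 ?normc_ge0 ?vnorm_ge0.
Qed.

Lemma vnormD v w : vnorm (v + w) <= vnorm v + vnorm w.
Proof.
rewrite -ler_sqr ?nnegrE ?addr_ge0 ?vnorm_ge0// sqr_vnorm.
have cs : \sum_i normc (v i 0) * normc (w i 0) <= vnorm v * vnorm w.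
  have s0 : 0 <= \sum_i normc (v i 0) * normc (w i 0).
    by apply: sumr_ge0 => i _; rewrite mulr_ge0 ?normc_ge0.
  rewrite -ler_sqr ?nnegrE ?mulr_ge0 ?vnorm_ge0//.
  by rewrite exprMn !sqr_vnorm; exact: cauchy_schwarz_sum.
apply: (@le_trans _ _ (\sum_i (normc (v i 0) + normc (w i 0)) ^+ 2)).
  apply: ler_sum => i _; rewrite mxE ler_sqr ?nnegrE ?addr_ge0 ?normc_ge0//.
  exact: le_normcD.
under eq_bigr do rewrite sqrrD.
rewrite !big_split /= -!sqr_vnorm sqrrD lerD2r lerD2l.
by rewrite mulr2n lerD.
Qed.

Lemma vnorm_sum (I : Type) (s : seq I) (P : pred I) (F : I -> 'cV[R[i]]_n) :
  vnorm (\sum_(i <- s | P i) F i) <= \sum_(i <- s | P i) vnorm (F i).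
Proof.
elim/big_ind2: _ => [|x a y b xa yb|//]; first by rewrite vnorm0.
exact: le_trans (vnormD _ _) (lerD xa yb).
Qed.

End Vectors.

Lemma vnorm_delta n (j : 'I_n) : vnorm (delta_mx j 0 : 'cV[R[i]]_n) = 1.
Proof.
rewrite /vnorm (bigD1 j)//= big1 => [|i ij]; rewrite mxE.
  by rewrite !eqxx ComplexField.Normc.normc1 expr1n addr0 sqrtr1.
by rewrite (negbTE ij) ComplexField.Normc.normc0 expr0n.
Qed.

(** * Inequalities for the operator norm *)

Section Operators.
Variable n : nat.
Implicit Types (A B : 'M[R[i]]_n).

Lemma mulmx_colE A (v : 'cV[R[i]]_n) : A *m v = \sum_j v j 0 *: col j A.
Proof.
apply/matrixP => i k; rewrite (ord1 k) !mxE summxE.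
by apply: eq_bigr => j _; rewrite !mxE mulrC.
Qed.

(** A crude finite bound, which makes the set under [sup] in [opnorm] bounded, so that [sup] is a
    genuine upper bound of it. *)
Lemma vnorm_mulmx_cols A (v : 'cV[R[i]]_n) :
  vnorm (A *m v) <= (\sum_j vnorm (col j A)) * vnorm v.
Proof.
rewrite mulmx_colE (le_trans (vnorm_sum _ _ _))// mulr_suml.
apply: ler_sum => j _; rewrite vnormZ mulrC.
by rewrite ler_wpM2l ?vnorm_ge0// normc_le_vnorm.
Qed.

Lemma opnorm_set_ubound A :
  has_ubound [set r : R | exists v : 'cV[R[i]]_n, vnorm v = 1 /\ r = vnorm (A *m v)].
Proof.
exists (\sum_j vnorm (col j A)) => r [v [v1 ->]].
by rewrite (le_trans (vnorm_mulmx_cols A v))// v1 mulr1.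
Qed.

Lemma vnorm_mulmx A (v : 'cV[R[i]]_n) : vnorm (A *m v) <= opnorm A * vnorm v.
Proof.
have [/vnorm_eq0 ->|v0] := eqVneq (vnorm v) 0; first by rewrite mulmx0 vnorm0 mulr0.
have vgt : 0 < vnorm v by rewrite lt_neqAle eq_sym v0 vnorm_ge0.
have nV : normc ((vnorm v)^-1)%:C%C = (vnorm v)^-1.
  by rewrite normc_real ger0_norm// invr_ge0 vnorm_ge0.
rewrite -ler_pdivrMr// mulrC -nV -vnormZ scalemxAr.
apply: ub_le_sup; first exact: opnorm_set_ubound.
by exists (((vnorm v)^-1)%:C%C *: v); rewrite vnormZ nV mulVf.
Qed.

Lemma opnorm_le A (c : R) : 0 <= c ->
  (forall v : 'cV[R[i]]_n, vnorm (A *m v) <= c * vnorm v) -> opnorm A <= c.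
Proof.
move=> c0 Ac; rewrite /opnorm; set E := (X in sup X).
(* In dimension 0 there is no unit vector, and [sup] of the empty set is 0. *)
have [->|/set0P ne] := eqVneq E set0; first by rewrite sup0.
by apply: ge_sup => // r [v [v1 ->]]; rewrite (le_trans (Ac v))// v1 mulr1.
Qed.

Lemma opnorm_ge0 A : 0 <= opnorm A.
Proof.
rewrite /opnorm; set E := (X in sup X).
have [->|/set0P [r Er]] := eqVneq E set0; first by rewrite sup0.
apply: (@le_trans _ _ r); first by case: Er => v [_ ->]; exact: vnorm_ge0.
exact: (ub_le_sup (opnorm_set_ubound A)).
Qed.

Lemma opnormD A B : opnorm (A + B) <= opnorm A + opnorm B.
Proof.
apply: opnorm_le => [|v]; first by rewrite addr_ge0 ?opnorm_ge0.
by rewrite mulmxDl mulrDl (le_trans (vnormD _ _))// lerD// vnorm_mulmx.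
Qed.

Lemma opnormM A B : opnorm (A *m B) <= opnorm A * opnorm B.
Proof.
apply: opnorm_le => [|v]; first by rewrite mulr_ge0 ?opnorm_ge0.
rewrite -mulmxA (le_trans (vnorm_mulmx _ _))// -mulrA.
by rewrite ler_wpM2l ?opnorm_ge0// vnorm_mulmx.
Qed.

Lemma opnormM_le A B (a b : R) :
  opnorm A <= a -> opnorm B <= b -> opnorm (A *m B) <= a * b.
Proof.
move=> Aa Bb; apply: le_trans (opnormM A B) _.
by apply: ler_pM Aa Bb; exact: opnorm_ge0.
Qed.

Lemma opnormZ_le z A : opnorm (z *: A) <= normc z * opnorm A.
Proof.
apply: opnorm_le => [|v]; first by rewrite mulr_ge0 ?opnorm_ge0 ?normc_ge0.
by rewrite -scalemxAl vnormZ -mulrA ler_wpM2l ?normc_ge0// vnorm_mulmx.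
Qed.

Lemma opnormN A : opnorm (- A) = opnorm A.
Proof.
suff h B : opnorm (- B) <= opnorm B.
  by apply/eqP; rewrite eq_le h /= -{1}[A]opprK h.
apply: opnorm_le => [|v]; first exact: opnorm_ge0.
rewrite mulNmx -scaleN1r vnormZ normcN ComplexField.Normc.normc1 mul1r.
exact: vnorm_mulmx.
Qed.

Lemma opnormB A B : opnorm (A - B) <= opnorm A + opnorm B.
Proof. by rewrite -(opnormN B) opnormD. Qed.

Lemma opnormD_le A B (a b : R) :
  opnorm A <= a -> opnorm B <= b -> opnorm (A + B) <= a + b.
Proof. by move=> Aa Bb; apply: le_trans (opnormD A B) (lerD Aa Bb). Qed.

Lemma opnorm0 : opnorm (0 : 'M[R[i]]_n) = 0.
Proof.
apply/eqP; rewrite eq_le opnorm_ge0 andbT; apply: opnorm_le => // v.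
by rewrite mul0mx vnorm0 mul0r.
Qed.

(* The norm of the identity is 0, not 1, in dimension 0. *)
Lemma opnorm1_le : opnorm (1%:M : 'M[R[i]]_n) <= 1.
Proof. by apply: opnorm_le => // v; rewrite mul1mx mul1r. Qed.

Lemma opnorm_sum (I : Type) (s : seq I) (P : pred I) (F : I -> 'M[R[i]]_n) :
  opnorm (\sum_(i <- s | P i) F i) <= \sum_(i <- s | P i) opnorm (F i).
Proof.
elim/big_ind2: _ => [|x a y b xa yb|//]; first by rewrite opnorm0.
exact: le_trans (opnormD _ _) (lerD xa yb).
Qed.

Lemma opnormX A k : opnorm (A ^+ k) <= opnorm A ^+ k.
Proof.
elim: k => [|k IH]; first exact: opnorm1_le.
by rewrite !exprS (le_trans (opnormM _ _))// ler_wpM2l ?opnorm_ge0.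
Qed.

Lemma normc_le_opnorm A i j : normc (A i j) <= opnorm A.
Proof.
have := le_trans (normc_le_vnorm (A *m delta_mx j 0) i) (vnorm_mulmx A _).
by rewrite vnorm_delta mulr1 -colE mxE.
Qed.

(** Turns entrywise convergence into convergence in operator norm. *)
Lemma opnorm_le_entries A : opnorm A <= \sum_i \sum_j normc (A i j).
Proof.
apply: opnorm_le => [|v].
  by apply: sumr_ge0 => i _; apply: sumr_ge0 => j _; exact: normc_ge0.
rewrite (le_trans (vnorm_mulmx_cols A v))// ler_wpM2r ?vnorm_ge0//.
rewrite exchange_big; apply: ler_sum => j _ /=.
have s0 : 0 <= \sum_i normc (A i j) by apply: sumr_ge0 => i _; exact: normc_ge0.
(* A sum of squares of nonnegative numbers is at most the square of their sum, since each of them is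
   at most that sum. *)
rewrite -ler_sqr ?nnegrE ?vnorm_ge0// sqr_vnorm expr2 mulr_suml.
apply: ler_sum => i _; rewrite mxE expr2 ler_wpM2l ?normc_ge0//.
by rewrite (bigD1 i)//= lerDl; apply: sumr_ge0 => k _; exact: normc_ge0.
Qed.

End Operators.

(* [adj_op] unfolds to this; rectangular so as to apply to vectors too. *)
Definition adjmx m n (A : 'M[R[i]]_(m, n)) : 'M[R[i]]_(n, m) :=
  \matrix_(i, j) (A j i)^*.

Lemma adjmxM m n p (A : 'M[R[i]]_(m, n)) (B : 'M[R[i]]_(n, p)) :
  adjmx (A *m B) = adjmx B *m adjmx A.
Proof.
apply/matrixP => i j; rewrite !mxE rmorph_sum; apply: eq_bigr => k _.
by rewrite !mxE rmorphM mulrC.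
Qed.

Lemma adjmxD m n (A B : 'M[R[i]]_(m, n)) : adjmx (A + B) = adjmx A + adjmx B.
Proof. by apply/matrixP => i j; rewrite !mxE rmorphD. Qed.

Lemma adjmxZ m n z (A : 'M[R[i]]_(m, n)) : adjmx (z *: A) = z^* *: adjmx A.
Proof. by apply/matrixP => i j; rewrite !mxE rmorphM. Qed.

Lemma adjmx0 m n : adjmx (0 : 'M[R[i]]_(m, n)) = 0.
Proof. by apply/matrixP => i j; rewrite !mxE rmorph0. Qed.

Lemma adjmx1 n : adjmx (1%:M : 'M[R[i]]_n) = 1%:M.
Proof.
apply/matrixP => i j; rewrite !mxE eq_sym.
by case: eqP => _; rewrite ?rmorph1 ?rmorph0.
Qed.

Lemma adjmx_sum m n (I : Type) (s : seq I) (P : pred I)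
    (F : I -> 'M[R[i]]_(m, n)) :
  adjmx (\sum_(i <- s | P i) F i) = \sum_(i <- s | P i) adjmx (F i).
Proof. exact: (big_morph _ (@adjmxD m n) (@adjmx0 m n)). Qed.

Lemma adjmxX n (A : 'M[R[i]]_n) k : adjmx (A ^+ k) = adjmx A ^+ k.
Proof.
elim: k => [|k IH]; first exact: adjmx1.
by rewrite exprSr exprS -mulmxE adjmxM IH.
Qed.

Lemma conjc_invn k : ((k%:R : R[i])^-1)^* = k%:R^-1.
Proof. by rewrite fmorphV rmorph_nat. Qed.

Lemma sqr_vnorm_adj n (v : 'cV[R[i]]_n) :
  (vnorm v ^+ 2)%:C%C = (adjmx v *m v) 0 0.
Proof.
rewrite sqr_vnorm mxE rmorph_sum; apply: eq_bigr => k _.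
by rewrite mxE -sqr_normcE.
Qed.

Lemma opnorm_isometry n (A : 'M[R[i]]_n) : adjmx A *m A = 1%:M -> opnorm A <= 1.
Proof.
move=> AA; apply: opnorm_le => // v; rewrite mul1r.
rewrite -ler_sqr ?nnegrE ?vnorm_ge0// -lecR !sqr_vnorm_adj.
by rewrite adjmxM mulmxA -(mulmxA _ _ A) AA mulmx1.
Qed.

(** The factor [n ^ 2] counts the entries; any constant independent of [A] gives the continuity of
    the adjoint in [mxcvg_adj]. *)
Lemma opnorm_adj_le n (A : 'M[R[i]]_n) :
  opnorm (adjmx A) <= (n ^ 2)%:R * opnorm A.
Proof.
rewrite (le_trans (opnorm_le_entries _))//.
apply: (@le_trans _ _ (\sum_(i < n) \sum_(j < n) opnorm A)).
  apply: ler_sum => i _; apply: ler_sum => j _.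
  by rewrite mxE normcJ normc_le_opnorm.
by rewrite !sumr_const !card_ord -mulrnA mulr_natl mulnn.
Qed.

End Norms.

(** * The matrix exponential *)

Section Exponential.
Variable R : realType.

Lemma cvgr0D (f g : nat -> R) :
  (f @ \oo --> (0 : R))%classic -> (g @ \oo --> (0 : R))%classic ->
  ((fun k => f k + g k) @ \oo --> (0 : R))%classic.
Proof.
move=> f0 g0.
have h : ((fun k => f k + g k) @ \oo --> (0 + 0 : R))%classic by exact: cvgD f0 g0.
by rewrite addr0 in h.
Qed.

Lemma cvgr0Ml (c : R) (f : nat -> R) : (f @ \oo --> (0 : R))%classic ->
  ((fun k => c * f k) @ \oo --> (0 : R))%classic.
Proof.
move=> f0.
have h : ((fun k => c * f k) @ \oo --> (c * 0 : R))%classic by exact: cvgMl_tmp.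
by rewrite mulr0 in h.
Qed.

Lemma cvgr0Mr (b : R) (f g : nat -> R) :
  (f @ \oo --> (0 : R))%classic -> (g @ \oo --> (b : R))%classic ->
  ((fun k => f k * g k) @ \oo --> (0 : R))%classic.
Proof.
move=> f0 g0.
have h : ((fun k => f k * g k) @ \oo --> (0 * b : R))%classic by exact: cvgM f0 g0.
by rewrite mul0r in h.
Qed.

(** * Convergence of matrices in operator norm *)

Section Convergence.
Variable n : nat.
Implicit Types (A B L M : 'M[R[i]]_n) (u v : nat -> 'M[R[i]]_n).

Definition mxcvg u L : Prop :=
  ((fun k => opnorm (u k - L)) @ \oo --> (0 : R))%classic.

Lemma mxcvg_squeeze u L (e : nat -> R) :
  (forall k, opnorm (u k - L) <= e k) -> (e @ \oo --> (0 : R))%classic ->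
  mxcvg u L.
Proof.
move=> ue e0; apply: (squeeze_cvgr _ (cvg_cst 0) e0).
by near=> k; rewrite opnorm_ge0 ue.
Unshelve. all: by end_near. Qed.

Lemma mxcvg_cst A : mxcvg (fun=> A) A.
Proof. by apply: (mxcvg_squeeze _ (cvg_cst 0)) => k; rewrite subrr opnorm0. Qed.

(** Closed balls are closed under limits. The shift to [k.+1] skips the empty partial sum of the
    exponential series, which violates the bound wanted in [opnorm_expmx_sub1] when, for instance,
    the exponent is 0. *)
Lemma mxcvg_opnorm_le u L B (c : R) : mxcvg u L ->
  (forall k, opnorm (u k.+1 - B) <= c) -> opnorm (L - B) <= c.
Proof.
move=> uL uB; apply/ler_addgt0Pr => e e0.
have /cvgr0_norm_lt/(_ _ e0) [N _ /(_ N.+1 (leqnSn N))] := uL.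
rewrite /= ger0_norm ?opnorm_ge0// => uN.
have -> : L - B = (u N.+1 - B) - (u N.+1 - L) by rewrite opprB [RHS]addrC addrA subrK.
by rewrite (le_trans (opnormB _ _))// lerD// ltW.
Qed.

Lemma opnorm_eq0 A : opnorm A <= 0 -> A = 0.
Proof.
move=> A0; apply/matrixP => i j; rewrite mxE.
apply: ComplexField.Normc.eq0_normc; apply/eqP.
by rewrite eq_le normc_ge0 (le_trans (normc_le_opnorm A i j)).
Qed.

Lemma mxcvgB u v L M : mxcvg u L -> mxcvg v M ->
  mxcvg (fun k => u k - v k) (L - M).
Proof.
move=> uL vM; apply: (@mxcvg_squeeze _ _
  (fun k => opnorm (u k - L) + opnorm (v k - M))) => [k|].
  have -> : u k - v k - (L - M) = (u k - L) - (v k - M).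
    by rewrite opprD addrACA -opprD.
  exact: opnormB.
exact (cvgr0D uL vM).
Qed.

Lemma mxcvg_unique u L M : mxcvg u L -> mxcvg u M -> L = M.
Proof.
move=> uL uM; apply/eqP; rewrite -subr_eq0; apply/eqP/opnorm_eq0.
rewrite -(subr0 (L - M)).
by apply: (mxcvg_opnorm_le (mxcvgB uL uM)) => k; rewrite subrr subr0 opnorm0.
Qed.

Lemma mxcvgM u v L M : mxcvg u L -> mxcvg v M ->
  mxcvg (fun k => u k *m v k) (L *m M).
Proof.
move=> uL vM; apply: (@mxcvg_squeeze _ _ (fun k =>
  opnorm (u k - L) * (opnorm (v k - M) + opnorm M)
  + opnorm L * opnorm (v k - M))) => [k|].
  have -> : u k *m v k - L *m M = (u k - L) *m (v k - M + M) + L *m (v k - M).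
    by rewrite subrK mulmxBl mulmxBr addrA subrK.
  rewrite (le_trans (opnormD _ _))// lerD// ?opnormM//.
  by rewrite (le_trans (opnormM _ _))// ler_wpM2l ?opnorm_ge0// opnormD.
apply: cvgr0D; last exact (cvgr0Ml _ vM).
apply: (cvgr0Mr uL (b := 0 + opnorm M)).
apply: (cvgD vM); exact: cvg_cst.
Qed.

Lemma mxcvg_adj u L : mxcvg u L -> mxcvg (fun k => adjmx (u k)) (adjmx L).
Proof.
move=> uL; apply: (@mxcvg_squeeze _ _ (fun k => (n ^ 2)%:R * opnorm (u k - L))).
  move=> k; have -> : adjmx (u k) - adjmx L = adjmx (u k - L).
    by apply/matrixP => i j; rewrite !mxE rmorphB.
  exact: opnorm_adj_le.
exact (cvgr0Ml _ uL).
Qed.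

End Convergence.

Lemma cvgr0_sum (I : Type) (s : seq I) (f : I -> nat -> R) :
  (forall i, (f i @ \oo --> (0 : R))%classic) ->
  ((fun k => \sum_(i <- s) f i k) @ \oo --> (0 : R))%classic.
Proof.
move=> f0; elim: s => [|i s IH].
  by under eq_fun do rewrite big_nil; exact: cvg_cst.
under eq_fun do rewrite big_cons.
exact: cvgr0D.
Qed.

(** * Convergence of the exponential series *)

Section Series.
Variable n : nat.
Implicit Types A B M : 'M[R[i]]_n.

Definition expterm M k : 'M[R[i]]_n := (k`!%:R)^-1 *: M ^+ k.

Lemma mxpowE M k : mxpow M k = M ^+ k.
Proof. by elim: k => [//|k IH]; rewrite /mxpow iterS -/(mxpow M k) IH exprS. Qed.

Lemma expsumE M N : expsum M N = \sum_(k < N) expterm M k.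
Proof. by apply: eq_bigr => k _; rewrite mxpowE. Qed.

Lemma normc_nat k : normc (k%:R : R[i]) = k%:R.
Proof. by rewrite -(rmorph_nat (real_complex R)) normc_real normr_nat. Qed.

Lemma opnorm_expterm M k : opnorm (expterm M k) <= exp_coeff (opnorm M) k.
Proof.
rewrite (le_trans (opnormZ_le _ _))// /exp_coeff /= mulrC.
by rewrite ComplexField.Normc.normcV normc_nat ler_wpM2r ?invr_ge0// opnormX.
Qed.

(** Here [f] is the real or the imaginary part; the series of entries is dominated by the scalar
    exponential series of [opnorm M]. *)
Lemma cvg_expsum_part (f : R[i] -> R) M i j :
  {morph f : x y / x + y} -> f 0 = 0 -> (forall z, `|f z| <= normc z) ->
  cvgn (fun N => f (expsum M N i j)).
Proof.
move=> fD f0 fle.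
have -> : (fun N => f (expsum M N i j)) = series (fun k => f (expterm M k i j)).
  apply/funext => N; rewrite expsumE summxE /series /=.
  by rewrite (big_morph f fD f0) big_mkord.
apply: normed_cvg; apply: (@series_le_cvg _ _ (exp_coeff (opnorm M))) => [k|k|k|].
- exact: normr_ge0.
- exact: exp_coeff_ge0 (opnorm_ge0 M).
- rewrite /= (le_trans (fle _))// (le_trans (normc_le_opnorm _ _ _))//.
  exact: opnorm_expterm.
- exact: is_cvg_series_exp_coeff.
Qed.

(** Passes from the entrywise limits that define [expmx] to norm convergence; all later facts on
    [expmx] rest on it. *)
Lemma expmx_cvg M : mxcvg (expsum M) (expmx M).
Proof.
have fR i j : (((fun N => complex.Re (expsum M N i j)) @ \oo) -->
    (complex.Re (expmx M i j) : R))%classic.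
  rewrite mxE /=; apply: cvg_expsum_part => [[? ?] [? ?]//|//|z].
  exact: Re_le_normc.
have fI i j : (((fun N => complex.Im (expsum M N i j)) @ \oo) -->
    (complex.Im (expmx M i j) : R))%classic.
  rewrite mxE /=; apply: cvg_expsum_part => [[? ?] [? ?]//|//|z].
  exact: Im_le_normc.
apply: (@mxcvg_squeeze _ _ _ (fun N => \sum_i \sum_j
  (`|complex.Re (expsum M N i j) - complex.Re (expmx M i j)|
  + `|complex.Im (expsum M N i j) - complex.Im (expmx M i j)|))) => [N|].
  rewrite (le_trans (opnorm_le_entries _))//.
  apply: ler_sum => i _; apply: ler_sum => j _.
  rewrite (le_trans (normc_le_ReIm _))// !mxE.
  by case: (expsum M N i j).
apply: cvgr0_sum => i; apply: cvgr0_sum => j.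
apply: cvgr0D; rewrite -(normr0 R); apply: cvg_norm; apply/subr_cvg0.
  exact: fR.
exact: fI.
Qed.

End Series.
End Exponential.

(** * Cauchy products of finite sums *)

Lemma sum_antidiag (P : nmodType) (F : nat -> nat -> P) N :
  \sum_(k < N) \sum_(i < k.+1) F (k - i)%N i =
  \sum_(0 <= i < N) \sum_(0 <= j < N - i) F j i.
Proof.
rewrite -(big_mkord xpredT (fun k => \sum_(i < k.+1) F (k - i)%N i)).
(* Widening the inner range to [N] under the guard [i <= k] allows the sums to be exchanged; then
   [k] is shifted by [i]. *)
have -> : \sum_(0 <= k < N) \sum_(i < k.+1) F (k - i)%N i =
    \sum_(0 <= k < N) \sum_(0 <= i < N | (i <= k)%N) F (k - i)%N i.
  apply: eq_big_nat => k /andP[_ kN].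
  by rewrite -(big_mkord xpredT (fun i => F (k - i)%N i)) (big_nat_widen 0 k.+1 N).
rewrite (exchange_big_dep_nat xpredT)//; apply: eq_big_nat => i /andP[_ iN].
rewrite -(big_nat_widenl i 0 N xpredT (fun j => F (j - i)%N i))//.
rewrite -[X in \sum_(X <= _ < _) _]add0n big_addn.
by apply: eq_bigr => j _; rewrite addnK.
Qed.

(** The remainder lives on the triangle [i, j < N], [N <= i + j]. It is stated in any ring so that
    the remainder for matrices can be dominated term by term by the one for scalars. *)
Lemma cauchy_product_remainder (P : pzRingType) (a b : nat -> P) N :
  (\sum_(j < N) a j) * (\sum_(i < N) b i)
    - \sum_(k < N) \sum_(i < k.+1) a (k - i)%N * b i =
  \sum_(0 <= i < N) \sum_(N - i <= j < N) a j * b i.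
Proof.
rewrite (sum_antidiag (fun j i => a j * b i)) big_distrlr exchange_big /=.
rewrite -(big_mkord xpredT (fun i => \sum_(j < N) a j * b i)) -sumrB.
apply: eq_big_nat => i _; rewrite -(big_mkord xpredT (fun j => a j * b i)).
by rewrite (big_cat_nat (leq0n (N - i)) (leq_subr i N)) /= [LHS]addrC addKr.
Qed.

(** The binomial theorem, with factorials multiplied out instead of divided by, so that it covers
    real numbers and matrices alike. *)
Lemma expterm_convolution (P : pzRingType) (A B : P) (a b : nat -> P) k :
  GRing.comm A B ->
  (forall j, a j *+ j`! = A ^+ j) -> (forall j, b j *+ j`! = B ^+ j) ->
  (\sum_(i < k.+1) a (k - i)%N * b i) *+ k`! = (A + B) ^+ k.
Proof.
move=> AB aE bE; rewrite exprDn_comm// -sumrMnl; apply: eq_bigr => i _.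
have ik : (i <= k)%N by rewrite -ltnS.
rewrite -(bin_fact ik) -aE -bE mulrnAl mulrnAr -!mulrnA.
congr (_ *+ _); ring.
Qed.

(** * Functional equation and norm bounds for the exponential *)

Section ExponentialLaws.
Variable R : realType.

Lemma exp_coeff_mulfact (x : R) k : exp_coeff x k *+ k`! = x ^+ k.
Proof.
by rewrite /exp_coeff /= -mulr_natr divfK// pnatr_eq0 -lt0n fact_gt0.
Qed.

Lemma exp_coeffD (x y : R) k :
  exp_coeff (x + y) k = \sum_(i < k.+1) exp_coeff x (k - i)%N * exp_coeff y i.
Proof.
apply: (pmulrnI (fact_gt0 k)).
rewrite exp_coeff_mulfact.
by rewrite (expterm_convolution k (mulrC x y)
  (exp_coeff_mulfact x) (exp_coeff_mulfact y)).
Qed.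

Lemma expR_cvg (x : R) :
  ((fun N => \sum_(k < N) exp_coeff x k) @ \oo --> expR x)%classic.
Proof.
have := is_cvg_series_exp_coeff x; rewrite /expR /series /=.
by under eq_fun do rewrite big_mkord.
Qed.

Variable n : nat.
Implicit Types A B M : 'M[R[i]]_n.

Lemma expterm_mulfact M k : expterm M k *+ k`! = M ^+ k.
Proof.
have f0 : (k`!%:R : R[i]) != 0 by rewrite pnatr_eq0 -lt0n fact_gt0.
by rewrite -scaler_nat scalerA divff// scale1r.
Qed.

Lemma exptermD A B k : A *m B = B *m A ->
  expterm (A + B) k = \sum_(i < k.+1) expterm A (k - i)%N *m expterm B i.
Proof.
move=> AB; have f0 : (k`!%:R : R[i]) != 0 by rewrite pnatr_eq0 -lt0n fact_gt0.
apply: (scalerI f0); rewrite !scaler_nat expterm_mulfact.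
exact/esym/(expterm_convolution k AB (expterm_mulfact A) (expterm_mulfact B)).
Qed.

Lemma expmxD A B : A *m B = B *m A -> expmx (A + B) = expmx A *m expmx B.
Proof.
move=> AB; apply/esym/eqP; rewrite -subr_eq0; apply/eqP.
apply: (mxcvg_unique (mxcvgB (mxcvgM (expmx_cvg A) (expmx_cvg B))
  (expmx_cvg (A + B)))).
set a := opnorm A; set b := opnorm B.
(* The scalar Cauchy remainder at the norms of [A] and [B]; it dominates the matrix remainder and
   tends to 0 because [expR] is already multiplicative. *)
pose e N := (\sum_(k < N) exp_coeff a k) * (\sum_(k < N) exp_coeff b k)
  - \sum_(k < N) exp_coeff (a + b) k.
apply: (@mxcvg_squeeze _ _ _ _ e) => [N|].
  have -> : expsum (A + B) N =
      \sum_(k < N) \sum_(i < k.+1) expterm A (k - i)%N * expterm B i.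
    by rewrite expsumE; apply: eq_bigr => k _; exact: exptermD.
  rewrite /e; have -> : \sum_(k < N) exp_coeff (a + b) k =
      \sum_(k < N) \sum_(i < k.+1) exp_coeff a (k - i)%N * exp_coeff b i.
    by apply: eq_bigr => k _; exact: exp_coeffD.
  rewrite subr0 !expsumE.
  rewrite (cauchy_product_remainder (exp_coeff a)) mulmxE.
  rewrite (cauchy_product_remainder (expterm A)).
  rewrite (le_trans (opnorm_sum _ _ _))//; apply: ler_sum => i _.
  rewrite (le_trans (opnorm_sum _ _ _))//; apply: ler_sum => j _.
  rewrite (le_trans (opnormM _ _))// ler_pM ?opnorm_ge0 ?opnorm_expterm//.
have h : (e @ \oo --> (expR a * expR b - expR (a + b) : R))%classic.
  exact (cvgB (cvgM (@expR_cvg a) (@expR_cvg b)) (@expR_cvg (a + b))).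
by rewrite expRD subrr in h.
Qed.

Lemma opnorm_expmx_sub1 M : opnorm (expmx M - 1%:M) <= expR (opnorm M) - 1.
Proof.
apply: (mxcvg_opnorm_le (expmx_cvg M)) => N.
(* The term of order 0 cancels the identity, here and in the scalar series below. *)
rewrite expsumE big_ord_recl /expterm fact0 invr1 scale1r expr0 addrC addKr.
rewrite (le_trans (opnorm_sum _ _ _))//.
apply: (@le_trans _ _ (\sum_(k < N.+1) exp_coeff (opnorm M) k - 1)).
  rewrite big_ord_recl {1}/exp_coeff /= fact0 invr1 mulr1 expr0 addrC addKr.
  by apply: ler_sum => k _; exact: opnorm_expterm.
rewrite lerD2r /expR.
rewrite -(big_mkord xpredT (exp_coeff (opnorm M))).
apply: (nondecreasing_cvgn_le _ (is_cvg_series_exp_coeff (opnorm M)) N.+1).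
by apply: nondecreasing_series => k _ _; exact: exp_coeff_ge0 (opnorm_ge0 M).
Qed.

Lemma expmx0 : expmx 0 = 1%:M :> 'M[R[i]]_n.
Proof.
apply/eqP; rewrite -subr_eq0; apply/eqP/opnorm_eq0.
by rewrite (le_trans (opnorm_expmx_sub1 _))// opnorm0 expR0 subrr.
Qed.

Lemma expmxNK M : expmx (- M) *m expmx M = 1%:M.
Proof. by rewrite -expmxD ?addNr ?expmx0// mulNmx mulmxN. Qed.

Lemma expmxMn M k : expmx (M *+ k) = expmx M ^+ k.
Proof.
elim: k => [|k IH]; first by rewrite mulr0n expmx0.
rewrite mulrS exprS -IH expmxD// -scaler_nat.
by rewrite -scalemxAl -scalemxAr.
Qed.

Lemma expmx_commute M B : M *m B = B *m M -> expmx M *m B = B *m expmx M.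
Proof.
move=> MB; have := mxcvgM (expmx_cvg M) (mxcvg_cst B).
suff -> : (fun N => expsum M N *m B) = (fun N => B *m expsum M N).
  by move/mxcvg_unique; apply; exact (mxcvgM (mxcvg_cst B) (expmx_cvg M)).
apply/funext => N; rewrite !expsumE mulmx_suml mulmx_sumr.
apply: eq_bigr => k _; rewrite -scalemxAl -scalemxAr; congr (_ *: _).
by apply/esym/commrX.
Qed.

Lemma adjmx_expmx M : adjmx (expmx M) = expmx (adjmx M).
Proof.
have := mxcvg_adj (expmx_cvg M).
suff -> : (fun N => adjmx (expsum M N)) = expsum (adjmx M).
  by move/mxcvg_unique; apply; exact: expmx_cvg.
apply/funext => N; rewrite !expsumE adjmx_sum; apply: eq_bigr => k _.
by rewrite /expterm adjmxZ conjc_invn adjmxX.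
Qed.

(** The adjoint of [expmx M] is [expmx (- M)], its inverse, so [expmx M] is an isometry. *)
Lemma opnorm_expmx_skew M : adjmx M = - M -> opnorm (expmx M) <= 1.
Proof. by move=> MN; apply: opnorm_isometry; rewrite adjmx_expmx MN expmxNK. Qed.

(* Splitting [exp M = exp (M / m) ^ m] and telescoping removes the exponential
   growth in the bound [expR (opnorm M) - 1], because each factor is unitary. *)
Lemma opnorm_expmx_skew_sub1 M : adjmx M = - M ->
  opnorm (expmx M - 1%:M) <= opnorm M.
Proof.
move=> MN; set c := opnorm M; have c0 : 0 <= c := opnorm_ge0 M.
have step m : opnorm (expmx M - 1%:M) <= c * expR (c * harmonic m).
  pose W : 'M[R[i]]_n := (m.+1%:R)^-1 *: M.
  have m0 : (m.+1%:R : R[i]) != 0 by rewrite pnatr_eq0.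
  have ME : M = W *+ m.+1 by rewrite -scaler_nat scalerA divff// scale1r.
  have WN : adjmx W = - W by rewrite adjmxZ conjc_invn MN scalerN.
  have Wc : opnorm W <= c * harmonic m.
    rewrite (le_trans (opnormZ_le _ _))//.
    by rewrite ComplexField.Normc.normcV normc_nat mulrC.
  have U1 k : opnorm (expmx W ^+ k) <= 1.
    rewrite (le_trans (opnormX _ _))// exprn_ile1 ?opnorm_ge0//.
    exact: opnorm_expmx_skew.
  have -> : expmx M - 1%:M = (expmx W - 1) *
      \sum_(i < m.+1) expmx W ^+ (m - i) * 1 ^+ i.
    by rewrite {1}ME expmxMn -subrXX_comm ?expr1n//; exact: commr1.
  rewrite (le_trans (opnormM _ _))//.
  have S : opnorm (\sum_(i < m.+1) expmx W ^+ (m - i) * 1 ^+ i) <= m.+1%:R.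
    rewrite (le_trans (opnorm_sum _ _ _))//.
    rewrite -[m.+1 in leRHS]card_ord -sumr_const; apply: ler_sum => i _.
    by rewrite expr1n mulr1.
  have E : opnorm (expmx W - 1) <= c * harmonic m * expR (c * harmonic m).
    rewrite (le_trans (opnorm_expmx_sub1 W))//.
    rewrite (@le_trans _ _ (expR (c * harmonic m) - 1))//.
      by rewrite lerD2r ler_expR.
    set x := c * harmonic m.
    (* Multiplying [1 - x <= expR (- x)] by [expR x] gives [expR x - 1 <= x * expR x]. *)
    have := ler_wpM2r (expR_ge0 x) (expR_ge1Dx (- x)).
    rewrite expRN mulVf ?gt_eqF ?expR_gt0// mulrDl mulNr mul1r.
    by move: (expR x) (x * expR x) => e xe; lra.
  apply: (@le_trans _ _ (c * harmonic m * expR (c * harmonic m) * m.+1%:R)).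
    by apply: ler_pM; rewrite ?opnorm_ge0.
  by rewrite mulrAC -(mulrA c) /harmonic /= mulVf ?pnatr_eq0// mulr1.
(* Since [harmonic m] is the inverse of [m.+1], the number of factors cancelled and only
   [c * expR (c * harmonic m)] is left, which tends to [c]. *)
have lim : ((fun m => c * expR (c * harmonic m)) @ \oo --> c * expR (c * 0))%classic.
  apply: cvgMl_tmp; apply: continuous_cvg; first exact: continuous_expR.
  by apply: cvgMl_tmp; exact: cvg_harmonic.
have := ler_cvg_to (cvg_cst (opnorm (expmx M - 1%:M))) lim.
rewrite mulr0 expR0 mulr1; apply.
by near=> m; exact: step.
Unshelve. all: by end_near. Qed.

End ExponentialLaws.

(** * Commuting dynamics *)

Section Conjugation.
Variables (R : realType) (n : nat).
Implicit Types A B K L u w z : 'M[R[i]]_n.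

Lemma expmxKN L : expmx L *m expmx (- L) = 1%:M.
Proof. by rewrite -{1}(opprK L) expmxNK. Qed.

Lemma adjmxN m (A : 'M[R[i]]_(m, n)) : adjmx (- A) = - adjmx A.
Proof. by apply/matrixP => i j; rewrite !mxE rmorphN. Qed.

Lemma opnorm_expmxN_skew L : adjmx L = - L -> opnorm (expmx (- L)) <= 1.
Proof. by move=> LN; apply: opnorm_expmx_skew; rewrite adjmxN LN. Qed.

(** The two exponentials are replaced by the identity one after the other, each at cost
    [opnorm K * opnorm A], as the remaining exponential has norm at most 1. *)
Lemma opnorm_conj_skew_sub K A : adjmx K = - K ->
  opnorm (expmx K *m A *m expmx (- K) - A) <= 2 * opnorm K * opnorm A.
Proof.
move=> KN; have NKN : adjmx (- K) = - - K by rewrite adjmxN KN.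
have -> : expmx K *m A *m expmx (- K) - A =
    (expmx K - 1%:M) *m (A *m expmx (- K)) + A *m (expmx (- K) - 1%:M).
  by rewrite mulmxBl mulmxBr mul1mx mulmx1 addrA subrK mulmxA.
have NK1 : opnorm (expmx (- K) - 1%:M) <= opnorm K.
  by rewrite -(opnormN K); exact: opnorm_expmx_skew_sub1 NKN.
have -> : 2 * opnorm K * opnorm A = opnorm K * (opnorm A * 1) + opnorm A * opnorm K.
  by move: (opnorm K) (opnorm A) => k a; ring.
apply: opnormD_le; last exact: opnormM_le (lexx _) NK1.
apply: opnormM_le (opnorm_expmx_skew_sub1 KN) _.
exact: opnormM_le (lexx _) (opnorm_expmxN_skew KN).
Qed.

Lemma opnorm_comm_le A B : opnorm (comm A B) <= 2 * opnorm A * opnorm B.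
Proof.
apply: le_trans (opnormB _ _) _.
apply: le_trans (lerD (opnormM A B) (opnormM B A)) _.
by move: (opnorm A) (opnorm B) => a b; rewrite le_eqVlt; apply/orP; left; apply/eqP; ring.
Qed.

(** The letters [u], [w], [z] stand for the exponentials of [L1], [K], [L2], the primed ones for
    those of the negatives. The pair [z], [z'] cancels across [A], the pair [u], [u'] leaves the
    commutator, and subtracting [A] is free because [A] commutes with [B]. *)
Lemma comm_conjugation u u' w w' z z' A B : z *m A = A *m z -> z *m z' = 1%:M ->
  u *m B = B *m u -> u' *m B = B *m u' -> A *m B = B *m A ->
  comm (u *m (w *m z) *m A *m (z' *m w' *m u')) B =
  u *m comm (w *m A *m w' - A) B *m u'.
Proof.
move=> zA zz' uB u'B AB.
have -> : u *m (w *m z) *m A *m (z' *m w' *m u') = u *m (w *m A *m w') *m u'.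
  rewrite !mulmxA -(mulmxA _ z A) zA !mulmxA.
  by rewrite -(mulmxA _ z z') zz' mulmx1.
set W := w *m A *m w'; have -> : comm (W - A) B = comm W B.
  by rewrite /comm mulmxBl mulmxBr AB opprB addrA subrK.
rewrite /comm mulmxBr mulmxBl !mulmxA uB; congr (_ - _).
by rewrite -[LHS]mulmxA u'B !mulmxA.
Qed.

(** The matrices [K], [L1], [L2] already carry the factor [i t], so self-adjointness of the
    interaction appears as skew-adjointness. *)
Lemma opnorm_comm_evolution K L1 L2 A B :
  adjmx K = - K -> adjmx L1 = - L1 ->
  K *m L1 = L1 *m K -> K *m L2 = L2 *m K -> L1 *m L2 = L2 *m L1 ->
  L2 *m A = A *m L2 -> L1 *m B = B *m L1 -> A *m B = B *m A ->
  opnorm (comm (expmx (L1 + (K + L2)) *m A *m expmx (- (L1 + (K + L2)))) B)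
    <= 4 * opnorm K * opnorm A * opnorm B.
Proof.
move=> KN L1N KL1 KL2 L12 L2A L1B AB.
have L1K2 : L1 *m (K + L2) = (K + L2) *m L1 by rewrite mulmxDr mulmxDl KL1 L12.
have neg M N : M *m N = N *m M -> - M *m - N = - N *m - M.
  by rewrite !mulNmx !mulmxN !opprK.
(* The exponential of the negative is factored in reversed order, to nest around [A] as in
   [comm_conjugation]. *)
rewrite expmxD// expmxD// addrC [K + L2]addrC !opprD.
rewrite (expmxD (A := - L2 - K)); last by rewrite -opprD addrC; exact: neg.
rewrite (expmxD (A := - L2)); last by apply: neg.
have NL1B : - L1 *m B = B *m - L1 by rewrite mulNmx mulmxN L1B.
have -> := comm_conjugation (expmx K) (expmx (- K)) (expmx_commute L2A)
  (expmxKN L2) (expmx_commute L1B) (expmx_commute NL1B) AB.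
(* One factor 2 comes from the commutator and one from [opnorm_conj_skew_sub]; the outer 1's bound
   the exponentials of [L1] and [- L1]. *)
have -> : 4 * opnorm K * opnorm A * opnorm B =
    1 * (2 * (2 * opnorm K * opnorm A) * opnorm B) * 1.
  by move: (opnorm K) (opnorm A) (opnorm B) => k a b; ring.
apply: opnormM_le (opnorm_expmxN_skew L1N).
apply: opnormM_le (opnorm_expmx_skew L1N) _.
apply: le_trans (opnorm_comm_le _ _) _.
apply: ler_wpM2r (opnorm_ge0 _) _ _ _; apply: ler_wpM2l (ler0n _ _) _ _ _.
exact: opnorm_conj_skew_sub.
Qed.

End Conjugation.

(** * Operators with disjoint supports *)

Section Locality.
Variables (R : realType) (V : finType) (q : nat).

(** The right-hand side is symmetric in the two factors, whence [local_commute]. *)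
Lemma embed_mulE (Z X : {set V}) (a : confZ q Z -> confZ q Z -> R[i])
    (b : confZ q X -> confZ q X -> R[i]) i j : [disjoint Z & X] ->
  (embed a *m embed b) i j =
  a (restr Z (cfg i)) (restr Z (cfg j)) * b (restr X (cfg i)) (restr X (cfg j))
  * ([forall x, (x \notin Z :|: X) ==> (cfg i x == cfg j x)])%:R.
Proof.
(* The only intermediate configuration that contributes: the first factor forces agreement with [i]
   off [Z], the second agreement with [j] off [X], hence on [Z]. *)
move=> dZX; pose f : conf V q := [ffun x => if x \in Z then cfg j x else cfg i x].
have fE : cfg (enum_rank f) = f by exact: enum_rankK.
rewrite mxE (bigD1 (enum_rank f))//= big1 => [|k kf]; last first.
  rewrite !mxE; case: forallP => [Zk|_]; last by rewrite mulr0 mul0r.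
  case: forallP => [Xk|_]; last by rewrite !mulr0.
  case/eqP: kf; apply: enum_val_inj; rewrite -/(cfg k) -/(cfg _) fE.
  apply/ffunP => x; rewrite ffunE; case: ifPn => xZ.
    by have /implyP/(_ (negbT (disjointFr dZX xZ)))/eqP := Xk x.
  by have /implyP/(_ xZ)/eqP := Zk x.
rewrite addr0 !mxE fE.
have -> : restr Z f = restr Z (cfg j).
  by apply/ffunP => -[x xZ]; rewrite !ffunE /= xZ.
have -> : restr X f = restr X (cfg i).
  by apply/ffunP => -[x xX]; rewrite !ffunE /= (disjointFl dZX xX).
have -> : [forall x, (x \notin Z) ==> (cfg i x == f x)].
  by apply/forallP => x; apply/implyP => /negbTE xZ; rewrite ffunE xZ.
rewrite mulr1 mulrA; congr (_ * (nat_of_bool _)%:R); apply: eq_forallb => x.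
by rewrite ffunE !inE; case: ifPn => //= _; rewrite eqxx implybT.
Qed.

Lemma local_commute (Z X : {set V}) (P A : op R V q) :
  local Z P -> local X A -> [disjoint Z & X] -> P *m A = A *m P.
Proof.
move=> [a ->] [b ->] dZX; apply/matrixP => i j.
by rewrite embed_mulE// embed_mulE 1?disjoint_sym// finset.setUC [a _ _ * _]mulrC.
Qed.

End Locality.

(** * Decay as a function of the distance between sets *)

Section Distance.
Variables (R : realType) (V : finType).

Lemma ominA : associative omin.
Proof. by move=> [a|] [b|] [c|] //=; rewrite minnA. Qed.

Lemma ominC : commutative omin.
Proof. by move=> [a|] [b|] //=; rewrite minnC. Qed.

Lemma omin0n : left_id None omin. Proof. by case. Qed.

(** Allows [bigD1] to isolate a chosen pair in the minimum that defines [setdist]. *)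
HB.instance Definition _ := Monoid.isComLaw.Build (option nat) None omin
  ominA ominC omin0n.

Lemma Falpha_ge0 (alpha : R) r : 0 <= Falpha alpha r.
Proof. by case: r => [m|] //=; exact: powR_ge0. Qed.

(** The decay is antitone, and infinite distance carries its least value 0. *)
Lemma Falpha_omin (alpha : R) a b : 0 < alpha ->
  Falpha alpha a <= Falpha alpha (omin a b).
Proof.
move=> a0; case: a b => [m|] b; last exact: Falpha_ge0.
case: b => [p|]; last exact: lexx.
rewrite /Falpha /=; set d := minn m p; have : (d <= m)%N by exact: geq_minl.
move: d => d dm.
rewrite !powRN lef_pV2 ?posrE ?powR_gt0 ?ltr_pwDl//.
by apply: ge0_ler_powR; rewrite ?nnegrE ?addr_ge0 ?(ltW a0)// lerD2l ler_nat.
Qed.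

Lemma Falpha_setdist (alpha : R) (adj : rel V) (X Y : {set V}) x y :
  0 < alpha -> x \in X -> y \in Y ->
  Falpha alpha (gdist adj x y) <= Falpha alpha (setdist adj X Y).
Proof.
move=> a0 xX yY; rewrite /setdist (bigD1 x)//= (bigD1 y yY)/=.
exact: le_trans (Falpha_omin _ _ a0) (Falpha_omin _ _ a0).
Qed.

End Distance.

(** * Sums of interaction terms *)

Section Interaction.
Variables (R : realType) (V : finType) (adj : rel V) (q : nat).
Variable Psi : {set V} -> op R V q.

Lemma Fnorm_ge0 (F : option nat -> R) : 0 <= Fnorm adj F Psi.
Proof. exact: bigmax_ge_id. Qed.

Lemma psum_le_Fnorm (alpha : R) x y : Fnorm_finite adj (Falpha alpha) Psi ->
  psum Psi x y <= Fnorm adj (Falpha alpha) Psi * Falpha alpha (gdist adj x y).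
Proof.
move=> [C /(_ x y) pC].
(* At infinite distance the quotient in [Fnorm] carries no information; the finiteness bound itself
   then forces [psum Psi x y <= 0]. *)
have [F0|F0] := eqVneq (Falpha alpha (gdist adj x y)) 0.
  by move: pC; rewrite F0 !mulr0.
have Fp : 0 < Falpha alpha (gdist adj x y) by rewrite lt_def F0 Falpha_ge0.
rewrite -ler_pdivrMr// /Fnorm.
apply: le_trans (le_bigmax 0 (fun x => \big[Num.max/0]_y _) x).
exact: (le_bigmax 0 (fun y => psum Psi x y / Falpha alpha (gdist adj x y))).
Qed.

(** A set [Z] meeting both [X] and [Y] contains some pair [x], [y], so its norm occurs at least once
    in the double sum, whose other terms are nonnegative. *)
Lemma sum_opnorm_meeting_le (X Y : {set V}) :
  \sum_(Z : {set V} | ~~ [disjoint Z & X] && ~~ [disjoint Z & Y]) opnorm (Psi Z) <=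
  \sum_(x in X) \sum_(y in Y) psum Psi x y.
Proof.
pose f (Z : {set V}) x y := if (x \in Z) && (y \in Z) then opnorm (Psi Z) else 0.
have f0 Z x y : 0 <= f Z x y by rewrite /f; case: ifP => // _; exact: opnorm_ge0.
have -> : \sum_(x in X) \sum_(y in Y) psum Psi x y =
    \sum_Z \sum_(x in X) \sum_(y in Y) f Z x y.
  rewrite [RHS]exchange_big; apply: eq_bigr => x _.
  rewrite [RHS]exchange_big; apply: eq_bigr => y _.
  by rewrite /psum big_mkcond.
rewrite [leLHS]big_mkcond; apply: ler_sum => Z _; case: ifPn => [/andP[]|_].
  move=> /pred0Pn[x /andP[xZ xX]] /pred0Pn[y /andP[yZ yY]].
  have fE : f Z x y = opnorm (Psi Z).
    by rewrite /f (xZ : x \in Z) (yZ : y \in Z).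
  rewrite (bigD1 x)//= (bigD1 y)//= fE -addrA lerDl.
  by rewrite addr_ge0// ?sumr_ge0// => x' _; exact: sumr_ge0.
by apply: sumr_ge0 => x _; exact: sumr_ge0.
Qed.

Lemma sum_psum_le (alpha : R) (X Y : {set V}) : 0 < alpha ->
  Fnorm_finite adj (Falpha alpha) Psi ->
  \sum_(x in X) \sum_(y in Y) psum Psi x y <=
  Fnorm adj (Falpha alpha) Psi * #|X|%:R * #|Y|%:R
    * Falpha alpha (setdist adj X Y).
Proof.
move=> a0 fin; set N := Fnorm _ _ _; set D := Falpha _ _.
apply: (@le_trans _ _ (\sum_(x in X) \sum_(y in Y) N * D)).
  apply: ler_sum => x xX; apply: ler_sum => y yY.
  rewrite (le_trans (psum_le_Fnorm x y fin))//.
  by rewrite ler_wpM2l ?Fnorm_ge0// Falpha_setdist.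
rewrite !sumr_const -(mulr_natr (N * D *+ #|Y|)) -(mulr_natr (N * D)).
by rewrite le_eqVlt; apply/orP; left; apply/eqP; ring.
Qed.

Lemma commuting_sums (P Q : pred {set V}) : commuting Psi ->
  (\sum_(Z | P Z) Psi Z) *m (\sum_(Z | Q Z) Psi Z) =
  (\sum_(Z | Q Z) Psi Z) *m (\sum_(Z | P Z) Psi Z).
Proof.
move=> cP; rewrite mulmx_suml mulmx_sumr; apply: eq_bigr => Z _.
by rewrite mulmx_suml mulmx_sumr; apply: eq_bigr => Z' _.
Qed.

Lemma commute_sum_local (P : pred {set V}) (X : {set V}) (A : op R V q) :
  interaction Psi -> local X A -> (forall Z, P Z -> [disjoint Z & X]) ->
  (\sum_(Z | P Z) Psi Z) *m A = A *m (\sum_(Z | P Z) Psi Z).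
Proof.
move=> iP lA PX; rewrite mulmx_suml mulmx_sumr; apply: eq_bigr => Z /PX.
by apply: local_commute lA; have [] := iP Z.
Qed.

Lemma skew_sum (P : pred {set V}) (t : R) : interaction Psi ->
  adjmx (('i * t%:C)%C *: \sum_(Z | P Z) Psi Z) =
  - (('i * t%:C)%C *: \sum_(Z | P Z) Psi Z).
Proof.
move=> iP; rewrite adjmxZ adjmx_sum -scaleNr; congr (_ *: _).
  change (conjc ('i * t%:C)%C = - ('i * t%:C)%C).
  by apply/eqP; rewrite eq_complex /= !mul0r !mul1r !subr0 !add0r oppr0 !eqxx.
by apply: eq_bigr => Z _; have [_] := iP Z.
Qed.

End Interaction.

Theorem theorem3p4 (R : realType) (alpha : R) (V : finType) (adj : rel V)
  (q : nat) (Psi : {set V} -> op R V q) :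
  0 < alpha ->
  symmetric adj ->
  interaction Psi ->
  commuting Psi ->
  Fnorm_finite adj (Falpha alpha) Psi ->
  forall (X Y : {set V}) (A B : op R V q) (t : R),
    [disjoint X & Y] ->
    local X A -> local Y B ->
    opnorm (comm (tau Psi t A) B)
      <= 4 * Fnorm adj (Falpha alpha) Psi * opnorm A * opnorm B
           * #|X|%:R * #|Y|%:R * `|t| * Falpha alpha (setdist adj X Y).
Proof.
move=> a0 _ iPsi cPsi fin X Y A B t dXY lA lB.
set c := ('i * t%:C)%C : R[i].
pose meets (T Z : {set V}) := ~~ [disjoint Z & T].
pose S (P : {set V} -> bool) := \sum_(Z | P Z) Psi Z.
pose K := S (fun Z => meets X Z && meets Y Z).
pose L1 := S (fun Z => meets X Z && ~~ meets Y Z).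
pose L2 := S (fun Z => ~~ meets X Z).
have HE : hamiltonian Psi = L1 + (K + L2).
  rewrite /hamiltonian (bigID (meets X)) /= (bigID (meets Y)) /=.
  by rewrite -/L2 -/L1 -/K addrAC addrC addrA addrC addrCA.
have cS P Q : (c *: S P) *m (c *: S Q) = (c *: S Q) *m (c *: S P).
  by rewrite -!scalemxAl -!scalemxAr /S commuting_sums.
have evol : opnorm (comm (tau Psi t A) B) <=
    4 * opnorm (c *: K) * opnorm A * opnorm B.
  (* The scalar goes inside the splitting, giving the exponents the form [L1 + (K + L2)] and its
     negative. *)
  rewrite /tau -/c scaleNr HE !scalerDr.
  apply: opnorm_comm_evolution; try exact: cS; try exact: skew_sum.
  - rewrite -scalemxAl -scalemxAr; congr (_ *: _).
    by apply: (commute_sum_local iPsi lA) => Z /negPn.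
  - rewrite -scalemxAl -scalemxAr; congr (_ *: _).
    by apply: (commute_sum_local iPsi lB) => Z /andP[_ /negPn].
  - exact: local_commute lA lB dXY.
have cE : normc c = `|t|.
  by rewrite /c ComplexField.Normc.normcM normc_real /= expr0n expr1n add0r sqrtr1 mul1r.
have KE : opnorm (c *: K) <= `|t| * (Fnorm adj (Falpha alpha) Psi * #|X|%:R
    * #|Y|%:R * Falpha alpha (setdist adj X Y)).
  rewrite (le_trans (opnormZ_le _ _))// cE ler_wpM2l//.
  rewrite (le_trans (opnorm_sum _ _ _))//.
  rewrite (le_trans (sum_opnorm_meeting_le Psi X Y))//.
  exact: sum_psum_le.
rewrite (le_trans evol)//.
set D := Falpha _ _ in KE *; set N := Fnorm _ _ _ in KE *.
have -> : 4 * N * opnorm A * opnorm B * #|X|%:R * #|Y|%:R * `|t| * D =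
  4 * (`|t| * (N * #|X|%:R * #|Y|%:R * D)) * opnorm A * opnorm B.
  by move: (opnorm A) (opnorm B) `|t| => a b s; ring.
by rewrite !ler_wpM2r ?opnorm_ge0// ler_wpM2l.
Qed.
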